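(* For every positive rational $\epsilon$, there are $2^{\aleph_0}$ many reals $x\in 2^\omega$ that are $h$-jump traceable for $h(n)=n^{1+\epsilon}$.
   Context: For an order function $h$ (computable, nondecreasing, unbounded), a real $x$ is $h$-jump traceable if for each Turing functional $\Phi$ there is a uniformly c.e. sequence of finite sets $(U_n)$ with $|U_n|\le h(n)$ for all $n$ such that, if $\Phi^x$ is total, then $\Phi^x(n)\in U_n$ for almost every $n$. *)

(* Defs.v *)
From Stdlib Require Import Arith List.
Import ListNotations.

Inductive instr : Type :=
  | Inc (r : nat)
  | JzDec (r j : nat)
  | Orac (r : nat).

(* A program; an index/code for a Turing functional Phi. *)
Definition prog := list instr.

Definition upd (regs : nat -> nat) (r v : nat) : nat -> nat :=
  fun i => if Nat.eqb i r then v else regs i.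

Fixpoint run (fuel : nat) (p : prog) (X : nat -> bool) (pc : nat) (regs : nat -> nat)
  : option (nat -> nat) :=
  match fuel with
  | 0 => None
  | S k =>
    match nth_error p pc with
    | None => Some regs
    | Some (Inc r) => run k p X (S pc) (upd regs r (S (regs r)))
    | Some (JzDec r j) =>
        if Nat.eqb (regs r) 0 then run k p X j regs
        else run k p X (S pc) (upd regs r (pred (regs r)))
    | Some (Orac r) => run k p X (S pc) (upd regs r (if X (regs r) then 1 else 0))
    end
  end.

Definition init (args : list nat) : nat -> nat := fun i => nth i args 0.

Definition conv (Phi : prog) (X : nat -> bool) (n y : nat) : Prop :=
  exists s regs, run s Phi X 0 (init [n]) = Some regs /\ regs 0 = y.

Definition total (Phi : prog) (X : nat -> bool) : Prop :=
  forall n, exists y, conv Phi X n y.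

(* The uniformly c.e. sequence (U_n) coded by the (oracle-free) machine V:
   y in U_n iff V halts on input (n, y). *)
Definition ucemem (V : prog) (n y : nat) : Prop :=
  exists s regs, run s V (fun _ => false) 0 (init [n; y]) = Some regs.

Definition card_le (U : nat -> Prop) (k : nat) : Prop :=
  exists l : list nat, length l <= k /\ forall y, U y -> In y l.

Definition jump_traceable (h : nat -> nat) (x : nat -> bool) : Prop :=
  forall Phi : prog, exists V : prog,
    (forall n, card_le (ucemem V n) (h n)) /\
    (total Phi x ->
       exists N, forall n, N <= n -> forall y, conv Phi x n y -> ucemem V n y).

Fixpoint iroot_aux (q m k : nat) : nat :=
  match k with
  | 0 => 0
  | S k' => if Nat.leb (S k' ^ q) m then S k' else iroot_aux q m k'
  end.
Definition iroot (q m : nat) : nat := iroot_aux q m m.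

(* h(n) = floor(n^(1 + p/q)) = floor((n^(q+p))^(1/q)). *)
Definition h_eps (p q : nat) (n : nat) : nat := iroot q (n ^ (q + p)).

(* Main.v *)
Require Import Defs.
From Stdlib Require Import Arith List.
From Stdlib Require Import Lia Bool Classical ConstructiveEpsilon IndefiniteDescription Cantor.
Import ListNotations.

(** Forcing with computable perfect trees, presented as computable nonexpanding
    injections [G] of Cantor space into itself (the image of [G] is the set of
    branches). Given [G] and a functional [p], either some finite string forces
    [p] to be partial on the image of [G], and one passes to the extensions of
    that string; or computations can always be made to converge by extending
    strings, and then a search yields a subtree on which the value at [n] is
    decided after [log2 n] branchings. In the second case at most [n <= n^(1+eps)]
    values are possible, and they form a computable set. Iterating over all
    functionals, with one branching left free at each stage, gives a continuum
    of reals, each obtained as a limit since every stage is a contraction. *)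

(** * Structured programs and their compilation *)

(** Each functional needs only a machine for its own trace; nothing has to be uniform in the
    functional. So the choice between the two cases, the enumeration of the functionals and the
    order of the stages may be noneffective, as long as every single tree is computable. A trace is
    the halting set of a concrete register machine, so the search that builds a tree must become a
    program. Absolute jump targets do not compose, hence the detour through structured commands.
    These have no oracle instruction: machines with an oracle are only ever simulated, with the
    oracle given by the binary digits of a number. *)

Inductive cmd : Type :=
  | Skip
  | IncC (r : nat)
  | Seq (c1 c2 : cmd)
  | Loop (r : nat) (c : cmd).

(* [Loop r c] is "while r <> 0 do (r := r - 1; c)". *)
Inductive exec : cmd -> (nat -> nat) -> (nat -> nat) -> Prop :=
  | exec_skip s : exec Skip s s
  | exec_inc r s : exec (IncC r) s (upd s r (S (s r)))
  | exec_seq c1 c2 s1 s2 s3 :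
      exec c1 s1 s2 -> exec c2 s2 s3 -> exec (Seq c1 c2) s1 s3
  | exec_loop_stop r c s : s r = 0 -> exec (Loop r c) s s
  | exec_loop_next r c s1 s2 s3 :
      s1 r <> 0 -> exec c (upd s1 r (pred (s1 r))) s2 ->
      exec (Loop r c) s2 s3 -> exec (Loop r c) s1 s3.

Fixpoint reg_bound (c : cmd) : nat :=
  match c with
  | Skip => 0
  | IncC r => S r
  | Seq c1 c2 => Nat.max (reg_bound c1) (reg_bound c2)
  | Loop r c => Nat.max (S r) (reg_bound c)
  end.

(* The register [z] holds 0 throughout, so that [JzDec z] is a jump. *)
Fixpoint compile (z off : nat) (c : cmd) : list instr :=
  match c with
  | Skip => []
  | IncC r => [Inc r]
  | Seq c1 c2 =>
      let p := compile z off c1 in p ++ compile z (off + length p) c2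
  | Loop r c =>
      let p := compile z (S off) c in
      JzDec r (off + S (S (length p))) :: p ++ [JzDec z off]
  end.

Local Arguments Nat.max : simpl never.

Lemma upd_same s r v : upd s r v r = v.
Proof. unfold upd. now rewrite Nat.eqb_refl. Qed.

Lemma upd_other s r v i : i <> r -> upd s r v i = s i.
Proof. intros H. unfold upd. now rewrite (proj2 (Nat.eqb_neq i r) H). Qed.

Lemma exec_fresh c s s' z : exec c s s' -> reg_bound c <= z -> s' z = s z.
Proof.
  induction 1; simpl; intros Hz; auto.
  - apply upd_other; lia.
  - rewrite IHexec2, IHexec1; auto; lia.
  - rewrite IHexec2, IHexec1 by (simpl; lia). apply upd_other; lia.
Qed.

Definition code_at (p : prog) (pc : nat) (code : list instr) : Prop :=
  forall i, i < length code -> nth_error p (pc + i) = nth_error code i.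

Lemma code_at_app p pc c1 c2 :
  code_at p pc (c1 ++ c2) -> code_at p pc c1 /\ code_at p (pc + length c1) c2.
Proof.
  intros H; split; intros i Hi.
  - rewrite H by (rewrite length_app; lia). now apply nth_error_app1.
  - rewrite <- Nat.add_assoc, H by (rewrite length_app; lia).
    rewrite nth_error_app2 by lia. f_equal; lia.
Qed.

Lemma code_at_head p pc i c : code_at p pc (i :: c) -> nth_error p pc = Some i.
Proof. intros H. specialize (H 0). rewrite Nat.add_0_r in H. apply H. simpl; lia. Qed.

Lemma code_at_tail p pc i c : code_at p pc (i :: c) -> code_at p (S pc) c.
Proof.
  intros H. replace (S pc) with (pc + length [i]) by (simpl; lia).
  now apply (code_at_app p pc [i] c).
Qed.

(** Quantifying over the leftover fuel [m] makes the fragments composable, and it also describes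
    runs that never halt after the compiled code. *)
Lemma compile_correct p X z c s s' :
  exec c s s' -> reg_bound c <= z -> s z = 0 ->
  forall pc, code_at p pc (compile z pc c) ->
  exists k, forall m,
    run (k + m) p X pc s = run m p X (pc + length (compile z pc c)) s'.
Proof.
  induction 1; simpl; intros Hz Hs pc Hc.
  - exists 0; intros m. simpl. now rewrite Nat.add_0_r.
  - exists 1; intros m. simpl. rewrite (code_at_head _ _ _ _ Hc).
    now rewrite Nat.add_1_r.
  - apply code_at_app in Hc as [Hc1 Hc2].
    destruct (IHexec1 ltac:(lia) Hs _ Hc1) as [k1 H1].
    assert (Hs2 : s2 z = 0) by (rewrite (exec_fresh _ _ _ z H) by lia; auto).
    destruct (IHexec2 ltac:(lia) Hs2 _ Hc2) as [k2 H2].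
    exists (k1 + k2); intros m.
    now rewrite <- Nat.add_assoc, H1, H2, length_app, Nat.add_assoc.
  - exists 1; intros m. simpl. rewrite (code_at_head _ _ _ _ Hc), H. simpl.
    rewrite length_app; simpl. f_equal; lia.
  - assert (Hs1 : upd s1 r (pred (s1 r)) z = 0) by (rewrite upd_other; auto; lia).
    pose proof (code_at_tail _ _ _ _ Hc) as Ht.
    apply code_at_app in Ht as [Hc1 Hj]. apply code_at_head in Hj. simpl in Hj.
    destruct (IHexec1 ltac:(lia) Hs1 _ Hc1) as [k1 H2].
    assert (Hs2 : s2 z = 0) by (rewrite (exec_fresh _ _ _ z H0) by lia; auto).
    destruct (IHexec2 ltac:(simpl; lia) Hs2 pc Hc) as [k2 H3].
    exists (S (k1 + S k2)); intros m. simpl.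
    rewrite (code_at_head _ _ _ _ Hc), (proj2 (Nat.eqb_neq _ _) H).
    rewrite <- Nat.add_assoc, H2. simpl. rewrite Hj, Hs2. simpl.
    apply H3.
Qed.

(** A calling convention: arguments sit in the registers [vs], the result goes to [d], and the other
    registers below [b] survive. Registers from [b] on are scratch space and may hold garbage before
    and after, so programs compose without cleanup. *)
Definition computable (f : list nat -> nat) : Prop :=
  forall vs b d, (forall v, In v vs -> v < b) -> d < b -> ~ In d vs ->
  exists c, forall s, exists s',
    exec c s s' /\ s' d = f (map s vs) /\
    forall r, r < b -> r <> d -> s' r = s r.

Lemma computable_ext f g : (forall l, f l = g l) -> computable f -> computable g.
Proof.
  intros E Hf vs b d H1 H2 H3. destruct (Hf vs b d H1 H2 H3) as [c Hc].
  exists c; intros s. destruct (Hc s) as [s' Hs']. exists s'.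
  now rewrite <- E.
Qed.

(** * Programs for the basic functions, substitution, iteration and search *)

Lemma exec_clear r s :
  exists s', exec (Loop r Skip) s s' /\ s' r = 0 /\ forall i, i <> r -> s' i = s i.
Proof.
  remember (s r) as n eqn:E. revert s E.
  induction n as [|n IH]; intros s E.
  - exists s; split; [now constructor|auto].
  - destruct (IH (upd s r n)) as (s' & H1 & H2 & H3).
    { now rewrite upd_same. }
    exists s'; split; [|split; auto].
    + eapply exec_loop_next; [lia| |exact H1]. rewrite <- E. constructor.
    + intros i Hi. rewrite H3 by auto. now apply upd_other.
Qed.

(** Reading a register destroys it; the second copy in [t] serves to refill [a] afterwards. *)
Lemma exec_drain a d t s :
  a <> d -> a <> t -> d <> t ->
  exists s', exec (Loop a (Seq (IncC d) (IncC t))) s s' /\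
    s' a = 0 /\ s' d = s d + s a /\ s' t = s t + s a /\
    forall i, i <> a -> i <> d -> i <> t -> s' i = s i.
Proof.
  intros N1 N2 N3. remember (s a) as n eqn:E. revert s E.
  induction n as [|n IH]; intros s E.
  - exists s; split; [now constructor|]. repeat split; auto; lia.
  - set (s1 := upd s a n).
    set (s2 := upd s1 d (S (s1 d))).
    set (s3 := upd s2 t (S (s2 t))).
    assert (A : s3 a = n).
    { unfold s3, s2, s1. now rewrite !upd_other, upd_same by auto. }
    assert (D : s3 d = S (s d)).
    { unfold s3, s2, s1. now rewrite upd_other, upd_same, upd_other by auto. }
    assert (T : s3 t = S (s t)).
    { unfold s3, s2, s1. now rewrite upd_same, !upd_other by auto. }
    destruct (IH s3) as (s' & H1 & H2 & H3 & H4 & H5); [auto|].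
    exists s'; split; [|repeat split; try lia].
    + eapply exec_loop_next; [lia| |exact H1]. rewrite <- E.
      econstructor; constructor.
    + intros i I1 I2 I3. rewrite H5 by auto. unfold s3, s2, s1.
      now rewrite !upd_other by auto.
Qed.

Lemma exec_restore a t s :
  a <> t ->
  exists s', exec (Loop t (IncC a)) s s' /\ s' a = s a + s t /\
    s' t = 0 /\ forall i, i <> a -> i <> t -> s' i = s i.
Proof.
  intros N. remember (s t) as n eqn:E. revert s E.
  induction n as [|n IH]; intros s E.
  - exists s; split; [now constructor|]. repeat split; auto; lia.
  - set (s1 := upd s t n). set (s2 := upd s1 a (S (s1 a))).
    assert (A : s2 a = S (s a)).
    { unfold s2, s1. now rewrite upd_same, upd_other by auto. }
    assert (T : s2 t = n).
    { unfold s2, s1. now rewrite upd_other, upd_same by auto. }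
    destruct (IH s2) as (s' & H1 & H2 & H3 & H4); [auto|].
    exists s'; split; [|repeat split; try lia].
    + eapply exec_loop_next; [lia| |exact H1]. rewrite <- E. constructor.
    + intros i I1 I2. rewrite H4 by auto. unfold s2, s1.
      now rewrite !upd_other by auto.
Qed.

Lemma computable_zero : computable (fun _ => 0).
Proof.
  intros vs b d _ _ _. exists (Loop d Skip). intros s.
  destruct (exec_clear d s) as (s' & H1 & H2 & H3). exists s'; auto.
Qed.

Lemma computable_nth i : computable (fun l => nth i l 0).
Proof.
  intros vs b d Hv Hd Hn. destruct (Nat.lt_ge_cases i (length vs)) as [Hi|Hi].
  - set (a := nth i vs 0).
    assert (Ia : In a vs) by now apply nth_In.
    assert (a < b) by auto.
    assert (a <> d) by (intros ->; auto).
    exists (Seq (Loop d Skip) (Seq (Loop b Skip)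
             (Seq (Loop a (Seq (IncC d) (IncC b))) (Loop b (IncC a))))).
    intros s.
    destruct (exec_clear d s) as (s1 & E1 & A1 & B1).
    destruct (exec_clear b s1) as (s2 & E2 & A2 & B2).
    destruct (exec_drain a d b s2) as (s3 & E3 & A3 & C3 & D3 & B3); try lia.
    destruct (exec_restore a b s3) as (s4 & E4 & A4 & C4 & B4); try lia.
    exists s4. split; [repeat (econstructor; eauto)|].
    assert (Hs : nth i (map s vs) 0 = s a).
    { rewrite (nth_indep _ 0 (s 0)) by (now rewrite length_map). apply map_nth. }
    rewrite Hs.
    assert (s2 a = s a) by (rewrite B2, B1; auto; lia).
    assert (s2 d = 0) by (rewrite B2; auto; lia).
    split; [rewrite B4 by lia; lia|].
    intros r Hr Hrd. destruct (Nat.eq_dec r a) as [->|Hra]; [lia|].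
    rewrite B4, B3, B2, B1; auto; lia.
  - destruct (computable_zero vs b d Hv Hd Hn) as [c Hc].
    exists c. intros s. now rewrite nth_overflow by (rewrite length_map; lia).
Qed.

Lemma computable_S f : computable f -> computable (fun l => S (f l)).
Proof.
  intros Hf vs b d H1 H2 H3. destruct (Hf vs b d H1 H2 H3) as [c Hc].
  exists (Seq c (IncC d)). intros s. destruct (Hc s) as (s' & E & D & P).
  exists (upd s' d (S (s' d))). split; [econstructor; eauto; constructor|].
  rewrite upd_same, D. split; auto.
  intros r Hr Hd. rewrite upd_other; auto.
Qed.

Lemma compute_list fs :
  Forall computable fs ->
  forall vs b t,
  (forall v, In v vs -> v < b /\ ~ (t <= v < t + length fs)) ->
  t + length fs <= b ->
  exists c, forall s, exists s',
    exec c s s' /\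
    map s' (seq t (length fs)) = map (fun f => f (map s vs)) fs /\
    forall r, r < b -> ~ (t <= r < t + length fs) -> s' r = s r.
Proof.
  induction 1 as [|f fs Hf _ IH]; intros vs b t Hv Hb; simpl in *.
  - exists Skip. intros s. exists s. repeat split; auto. constructor.
  - destruct (Hf vs b t) as [c1 H1]; [intros v Iv; apply Hv in Iv; lia|lia| |].
    { intros Iv; apply Hv in Iv; lia. }
    destruct (IH vs b (S t)) as [c2 H2]; [intros v Iv; apply Hv in Iv; lia|lia|].
    exists (Seq c1 c2). intros s.
    destruct (H1 s) as (s1 & E1 & A1 & B1).
    destruct (H2 s1) as (s2 & E2 & A2 & B2).
    assert (E : map s1 vs = map s vs).
    { apply map_ext_in. intros v Iv. apply Hv in Iv. apply B1; lia. }
    exists s2. split; [econstructor; eauto|]. split.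
    + rewrite A2, E, B2, A1 by lia. reflexivity.
    + intros r Hr Ht. rewrite B2, B1; lia.
Qed.

Lemma computable_subst f gs :
  computable f -> Forall computable gs ->
  computable (fun l => f (map (fun g => g l) gs)).
Proof.
  intros Hf Hgs vs b d Hv Hd Hn.
  destruct (compute_list gs Hgs vs (b + length gs) b) as [c1 H1]; auto.
  { intros v Iv; apply Hv in Iv; lia. }
  destruct (Hf (seq b (length gs)) (b + length gs) d) as [c2 H2].
  { intros v Iv. apply in_seq in Iv. lia. }
  { lia. }
  { intros Iv. apply in_seq in Iv. lia. }
  exists (Seq c1 c2). intros s.
  destruct (H1 s) as (s1 & E1 & A1 & B1).
  destruct (H2 s1) as (s2 & E2 & A2 & B2).
  exists s2. split; [econstructor; eauto|]. split.
  - now rewrite A2, A1.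
  - intros r Hr Hrd. rewrite B2, B1; lia.
Qed.

Lemma computable_skipn f k : computable f -> computable (fun l => f (skipn k l)).
Proof.
  intros Hf vs b d Hv Hd Hn.
  assert (I : forall v, In v (skipn k vs) -> In v vs).
  { intros v Iv. rewrite <- (firstn_skipn k vs). apply in_or_app; auto. }
  destruct (Hf (skipn k vs) b d) as [c Hc]; auto.
  exists c. intros s. rewrite skipn_map. apply Hc.
Qed.

Definition step_list (ss : list (list nat -> nat)) (l st : list nat) : list nat :=
  map (fun f => f (st ++ l)) ss.

Lemma nth_projections l : map (fun i => nth i l 0) (seq 0 (length l)) = l.
Proof.
  induction l as [|a l IH]; simpl; auto. f_equal.
  now rewrite <- seq_shift, map_map.
Qed.

(** Iteration of a whole vector of registers, so that machine configurations can be iterated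
    directly, without coding them into one number. *)
Lemma computable_iter ss inits m j :
  Forall computable ss -> Forall computable inits -> length inits = length ss ->
  computable m ->
  computable (fun l =>
    nth j (Nat.iter (m l) (step_list ss l) (map (fun f => f l) inits)) 0).
Proof.
  intros Hss Hin Hlen Hm vs b d Hv Hd Hn.
  set (k := length ss) in *.
  (* New values are buffered in [tmp] and then copied back, so that every component reads the old
     state. The counter [n] follows both blocks. *)
  set (st := seq b k). set (tmp := seq (b + k) k). set (n := b + k + k).
  set (projs := map (fun i (l : list nat) => nth i l 0) (seq 0 k)).
  assert (Lp : length projs = k) by (unfold projs; now rewrite length_map, length_seq).
  assert (Hp : Forall computable projs).
  { apply Forall_forall. intros f If. apply in_map_iff in If as (i & <- & _).
    apply computable_nth. }
  assert (Ist : forall v, In v st -> b <= v < b + k) by (intros v Iv; now apply in_seq).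
  assert (Itm : forall v, In v tmp -> b + k <= v < n)
    by (intros v Iv; apply in_seq in Iv; unfold n; lia).
  destruct (compute_list inits Hin vs (S n) b) as [c0 H0].
  { intros v Iv; apply Hv in Iv; lia. }
  { unfold n; lia. }
  destruct (Hm vs (S n) n) as [c1 H1]; [intros v Iv; apply Hv in Iv; lia|lia| |].
  { intros Iv; apply Hv in Iv; lia. }
  destruct (compute_list ss Hss (st ++ vs) (S n) (b + k)) as [c2 H2].
  { intros v Iv. apply in_app_or in Iv as [Iv|Iv]; [apply Ist in Iv|apply Hv in Iv]; lia. }
  { fold k; lia. }
  destruct (compute_list projs Hp tmp (S n) b) as [c3 H3].
  { intros v Iv. apply Itm in Iv. lia. }
  { lia. }
  destruct (computable_nth j st n d) as [c4 H4].
  { intros v Iv. apply Ist in Iv. lia. }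
  { lia. }
  { intros Iv. apply Ist in Iv. lia. }
  rewrite Hlen in H0. rewrite Lp in H3. fold k in H2. fold st in H0, H3. fold tmp in H2.
  assert (L : forall i s, s n = i -> exists s',
             exec (Loop n (Seq c2 c3)) s s' /\
             map s' st = Nat.iter i (step_list ss (map s vs)) (map s st) /\
             forall r, r < b -> s' r = s r).
  { induction i as [|i IH]; intros s Hs.
    - exists s. repeat split; auto. now constructor.
    - set (s0 := upd s n i).
      assert (Eb : forall r, r < n -> s0 r = s r)
        by (intros r Hr; apply upd_other; lia).
      destruct (H2 s0) as (s1 & E1 & A1 & B1).
      destruct (H3 s1) as (s2 & E2 & A2 & B2).
      destruct (IH s2) as (s3 & E3 & A3 & B3).
      { rewrite B2, B1 by lia. apply upd_same. }
      exists s3. split; [|split].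
      + eapply exec_loop_next; [lia| |exact E3]. rewrite Hs. econstructor; eauto.
      + rewrite A3, Nat.iter_succ_r.
        assert (Ev : map s2 vs = map s vs).
        { apply map_ext_in. intros v Iv. apply Hv in Iv.
          rewrite B2, B1, Eb; lia. }
        rewrite Ev. f_equal. rewrite A2. unfold projs. rewrite map_map.
        replace k with (length (map s1 tmp))
          by (unfold tmp; now rewrite length_map, length_seq).
        rewrite nth_projections, A1. unfold step_list.
        rewrite map_app.
        assert (Es : map s0 st = map s st).
        { apply map_ext_in. intros v Iv. apply Ist in Iv. apply Eb; lia. }
        assert (Ew : map s0 vs = map s vs).
        { apply map_ext_in. intros v Iv. apply Hv in Iv. apply Eb; lia. }
        now rewrite Es, Ew.
      + intros r Hr. rewrite B3, B2, B1, Eb; lia. }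
  exists (Seq c0 (Seq c1 (Seq (Loop n (Seq c2 c3)) c4))). intros s.
  destruct (H0 s) as (s1 & E1 & A1 & B1).
  destruct (H1 s1) as (s2 & E2 & A2 & B2).
  destruct (L _ s2 eq_refl) as (s3 & E3 & A3 & B3).
  destruct (H4 s3) as (s4 & E4 & A4 & B4).
  exists s4. split; [repeat (econstructor; eauto)|]. split.
  - rewrite A4, A3, A2.
    assert (Ev1 : map s1 vs = map s vs).
    { apply map_ext_in. intros v Iv. apply Hv in Iv. rewrite B1; lia. }
    assert (Ev2 : map s2 vs = map s vs).
    { rewrite <- Ev1. apply map_ext_in. intros v Iv. apply Hv in Iv. rewrite B2; lia. }
    assert (Es : map s2 st = map s1 st).
    { apply map_ext_in. intros v Iv. apply Ist in Iv. rewrite B2; lia. }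
    now rewrite Ev1, Ev2, Es, A1.
  - intros r Hr Hrd. rewrite B4, B3, B2, B1; lia.
Qed.

Definition least_zero (f : nat -> nat) (n : nat) : Prop :=
  f n = 0 /\ forall i, i < n -> f i <> 0.

(** The program counts [d] up and recomputes [f] into [b] until [b] is 0. The decrement made by
    [Loop] on [b] is harmless, as [b] is overwritten. *)
Lemma computable_mu f g :
  computable f -> (forall l, least_zero (fun i => f (i :: l)) (g l)) -> computable g.
Proof.
  intros Hf Hg vs b d Hv Hd Hn.
  destruct (Hf (d :: vs) (S b) b) as [c Hc].
  { intros v [<-|Iv]; [lia|]. apply Hv in Iv; lia. }
  { lia. }
  { intros [E|Iv]; [lia|]. apply Hv in Iv; lia. }
  exists (Seq (Loop d Skip) (Seq c (Loop b (Seq (IncC d) c)))). intros s.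
  destruct (exec_clear d s) as (s1 & E1 & A1 & B1).
  destruct (Hc s1) as (s2 & E2 & A2 & B2).
  set (l := map s vs).
  assert (L : forall j t, t d + j = g l -> map t vs = l ->
            t b = f (t d :: l) ->
            exists t', exec (Loop b (Seq (IncC d) c)) t t' /\ t' d = g l /\
              forall r, r < b -> r <> d -> t' r = t r).
  { destruct (Hg l) as [Z M].
    induction j as [|j IH]; intros t Ht Hl Hb.
    - exists t. split; [|split; auto; lia]. constructor.
      rewrite Hb. replace (t d) with (g l) by lia. exact Z.
    - set (t1 := upd t b (pred (t b))). set (t2 := upd t1 d (S (t1 d))).
      assert (T1 : t1 d = t d) by (apply upd_other; lia).
      assert (T2 : t2 d = S (t d)) by (unfold t2; now rewrite upd_same, T1).
      assert (T3 : forall r, r < b -> r <> d -> t2 r = t r)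
        by (intros r Hr Hrd; unfold t2, t1; rewrite !upd_other; lia).
      assert (Ev : map t2 vs = l).
      { rewrite <- Hl. apply map_ext_in. intros v Iv. apply T3; [auto|].
        intros ->; auto. }
      destruct (Hc t2) as (t3 & E3 & A3 & B3). simpl in A3. rewrite Ev in A3.
      assert (T4 : t3 d = S (t d)) by (rewrite B3; auto; lia).
      assert (Ev3 : map t3 vs = l).
      { rewrite <- Ev. apply map_ext_in. intros v Iv. apply Hv in Iv.
        apply B3; lia. }
      destruct (IH t3) as (t4 & E4 & A4 & B4); auto; [lia|congruence|].
      exists t4. split; [|split; auto].
      + eapply exec_loop_next; [|econstructor; [constructor|exact E3]|exact E4].
        rewrite Hb. apply M. lia.
      + intros r Hr Hrd. rewrite B4, B3, T3; auto; lia. }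
  assert (Ev : map s1 vs = l).
  { apply map_ext_in. intros v Iv. apply B1. intros ->; auto. }
  assert (Ev2 : map s2 vs = l).
  { rewrite <- Ev. apply map_ext_in. intros v Iv. apply Hv in Iv. apply B2; lia. }
  assert (D2 : s2 d = 0) by (rewrite B2; auto; lia).
  destruct (L (g l) s2) as (s3 & E3 & A3 & B3); auto; [lia| |].
  { rewrite A2. simpl. rewrite Ev, A1, D2. reflexivity. }
  exists s3. split; [repeat (econstructor; eauto)|]. split; auto.
  intros r Hr Hrd. rewrite B3, B2, B1; auto; lia.
Qed.

(** * Closure properties of computable functions *)

Lemma run_mono p X k m pc s s' :
  run k p X pc s = Some s' -> run (k + m) p X pc s = Some s'.
Proof.
  revert pc s. induction k as [|k IH]; intros pc s H; [discriminate|].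
  simpl in *. destruct (nth_error p pc) as [[r|r j|r]|]; auto.
  destruct (Nat.eqb (s r) 0); auto.
Qed.

(** All traces built below are decidable, so a machine that halts exactly on the zeros of a
    computable function is enough. *)
Lemma computable_decides_ucemem P :
  computable P -> exists V, forall n y, ucemem V n y <-> P [n; y] = 0.
Proof.
  intros HP.
  destruct (HP [0; 1] 3 2) as [c Hc].
  { intros v [<-|[<-|[]]]; lia. }
  { lia. }
  { intros [E|[E|[]]]; lia. }
  (* A register untouched by [c] and beyond the inputs, hence 0 throughout. *)
  set (z := Nat.max 3 (reg_bound c)).
  set (a := length (compile z 0 c)).
  (* If the result in register 2 is 0, jump past the end; otherwise undo the decrement and jump back
     forever. *)
  set (V := compile z 0 c ++ [JzDec 2 (a + 3); Inc 2; JzDec z a]).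
  assert (At : code_at V 0 (compile z 0 c)).
  { intros i Hi. now apply nth_error_app1. }
  assert (N : forall i, nth_error V (a + i) =
                nth_error [JzDec 2 (a + 3); Inc 2; JzDec z a] i).
  { intros i. unfold V. rewrite nth_error_app2 by (fold a; lia).
    f_equal. fold a. lia. }
  assert (N0 : nth_error V a = Some (JzDec 2 (a + 3)))
    by (rewrite <- (Nat.add_0_r a) at 1; apply (N 0)).
  assert (N1 : nth_error V (S a) = Some (Inc 2))
    by (rewrite <- Nat.add_1_r; apply (N 1)).
  assert (N2 : nth_error V (S (S a)) = Some (JzDec z a))
    by (replace (S (S a)) with (a + 2) by lia; apply (N 2)).
  assert (N3 : nth_error V (a + 3) = None) by apply (N 3).
  clearbody V.
  assert (Div : forall k s, s z = 0 -> s 2 <> 0 ->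
            run k V (fun _ => false) a s = None).
  { induction k as [k IH] using lt_wf_ind. intros s Hz H2.
    destruct k as [|k]; auto. cbn [run].
    rewrite N0, (proj2 (Nat.eqb_neq _ _) H2).
    destruct k as [|k]; auto. cbn [run]. rewrite N1.
    destruct k as [|k]; auto. cbn [run]. rewrite N2.
    rewrite !upd_other by (unfold z; lia). rewrite Hz. cbn [Nat.eqb].
    apply IH; [lia| |].
    - rewrite !upd_other; auto; unfold z; lia.
    - rewrite upd_same. lia. }
  exists V. intros n y.
  destruct (Hc (init [n; y])) as (s' & E & D & _). simpl in D.
  assert (Z0 : init [n; y] z = 0).
  { unfold init. apply nth_overflow. simpl. unfold z. lia. }
  assert (Z : s' z = 0).
  { rewrite (exec_fresh _ _ _ z E); auto. unfold z; lia. }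
  destruct (compile_correct V (fun _ => false) z c _ _ E ltac:(unfold z; lia) Z0 0 At)
    as [k Hk].
  change (0 + length (compile z 0 c)) with a in Hk.
  change (P [n; y]) with (P [init [n; y] 0; init [n; y] 1]). rewrite <- D. split.
  - intros (t & r & Hr). destruct (Nat.eq_dec (s' 2) 0) as [|H2]; auto.
    apply run_mono with (m := k) in Hr. rewrite Nat.add_comm, Hk, Div in Hr; auto.
    discriminate.
  - intros H2. exists (k + 2), s'. rewrite Hk. cbn [run]. rewrite N0, H2.
    cbn [Nat.eqb run]. now rewrite N3.
Qed.

Lemma computable_const n : computable (fun _ => n).
Proof.
  induction n as [|n IH]; [apply computable_zero|].
  exact (computable_S _ IH).
Qed.

Definition computable1 (F : nat -> nat) : Prop :=
  computable (fun l => F (nth 0 l 0)).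
Definition computable2 (F : nat -> nat -> nat) : Prop :=
  computable (fun l => F (nth 0 l 0) (nth 1 l 0)).
Definition computable3 (F : nat -> nat -> nat -> nat) : Prop :=
  computable (fun l => F (nth 0 l 0) (nth 1 l 0) (nth 2 l 0)).
Definition computable4 (F : nat -> nat -> nat -> nat -> nat) : Prop :=
  computable (fun l => F (nth 0 l 0) (nth 1 l 0) (nth 2 l 0) (nth 3 l 0)).

Lemma computable_app1 F f :
  computable1 F -> computable f -> computable (fun l => F (f l)).
Proof.
  intros HF Hf. exact (computable_subst _ [f] HF (Forall_cons _ Hf (Forall_nil _))).
Qed.

Lemma computable_app2 F f g :
  computable2 F -> computable f -> computable g ->
  computable (fun l => F (f l) (g l)).
Proof.
  intros HF Hf Hg. apply (computable_subst _ [f; g] HF). repeat constructor; auto.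
Qed.

Lemma computable_app3 F f g h :
  computable3 F -> computable f -> computable g -> computable h ->
  computable (fun l => F (f l) (g l) (h l)).
Proof.
  intros HF Hf Hg Hh. apply (computable_subst _ [f; g; h] HF).
  repeat constructor; auto.
Qed.

Lemma computable_app4 F f g h k :
  computable4 F -> computable f -> computable g -> computable h -> computable k ->
  computable (fun l => F (f l) (g l) (h l) (k l)).
Proof.
  intros HF Hf Hg Hh Hk. apply (computable_subst _ [f; g; h; k] HF).
  repeat constructor; auto.
Qed.

Lemma computable_nth_skipn i k : computable (fun l => nth i (skipn k l) 0).
Proof. apply (computable_skipn (fun l => nth i l 0)), computable_nth. Qed.

(** Iteration on pairs of counter and value; [skipn 2] recovers the parameters behind the pair. *)
Lemma computable_rec a b (s : nat -> nat -> list nat -> nat) :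
  computable a -> computable b ->
  computable (fun l => s (nth 0 l 0) (nth 1 l 0) (skipn 2 l)) ->
  computable (fun l => nat_rect (fun _ => nat) (a l) (fun n r => s n r l) (b l)).
Proof.
  intros Ha Hb Hs.
  set (ss := [(fun l => S (nth 0 l 0)); (fun l => s (nth 0 l 0) (nth 1 l 0) (skipn 2 l))]).
  refine (computable_ext _ _ _ (computable_iter ss [(fun _ => 0); a] b 1 _ _ eq_refl Hb)).
  - intros l. set (R := fun k => nat_rect (fun _ => nat) (a l) (fun n r => s n r l) k).
    assert (E : forall k, Nat.iter k (step_list ss l) [0; a l] = [k; R k]).
    { induction k as [|k IH]; auto. rewrite Nat.iter_succ, IH. reflexivity. }
    simpl map. now rewrite E.
  - repeat constructor; auto. apply computable_S, computable_nth.
  - repeat constructor; auto. apply computable_zero.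
Qed.

Create HintDb computable.
Ltac compu := intros; auto 20 with computable.

#[export] Hint Resolve computable_nth computable_nth_skipn computable_const
  computable_S : computable.


Lemma computable_add f g :
  computable f -> computable g -> computable (fun l => f l + g l).
Proof.
  intros Hf Hg. apply (computable_app2 Nat.add); auto.
  refine (computable_ext _ _ _ (computable_rec (fun l => nth 1 l 0) (fun l => nth 0 l 0)
            (fun _ r _ => S r) _ _ _)); compu.
  induction (nth 0 l 0); simpl; auto.
Qed.
#[export] Hint Resolve computable_add : computable.

Lemma computable_mul f g :
  computable f -> computable g -> computable (fun l => f l * g l).
Proof.
  intros Hf Hg. apply (computable_app2 Nat.mul); auto.
  refine (computable_ext _ _ _ (computable_rec (fun l => 0) (fun l => nth 0 l 0)
            (fun _ r l => nth 1 l 0 + r) _ _ _)); compu.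
  induction (nth 0 l 0); simpl; auto.
Qed.

Lemma computable_pred f : computable f -> computable (fun l => pred (f l)).
Proof.
  intros Hf. apply (computable_app1 pred); auto.
  refine (computable_ext _ _ _ (computable_rec (fun l => 0) (fun l => nth 0 l 0)
            (fun n _ _ => n) _ _ _)); compu.
  now destruct (nth 0 l 0).
Qed.
#[export] Hint Resolve computable_mul computable_pred : computable.

Lemma computable_sub f g :
  computable f -> computable g -> computable (fun l => f l - g l).
Proof.
  intros Hf Hg. apply (computable_app2 Nat.sub); auto.
  refine (computable_ext _ _ _ (computable_rec (fun l => nth 0 l 0) (fun l => nth 1 l 0)
            (fun _ r _ => pred r) _ _ _)); compu.
  induction (nth 1 l 0); simpl; lia.
Qed.

Lemma computable_pow2 f : computable f -> computable (fun l => 2 ^ f l).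
Proof.
  intros Hf. apply (computable_app1 (fun n => 2 ^ n)); auto.
  refine (computable_ext _ _ _ (computable_rec (fun l => 1) (fun l => nth 0 l 0)
            (fun _ r _ => r + r) _ _ _)); compu.
  induction (nth 0 l 0); simpl; lia.
Qed.
#[export] Hint Resolve computable_sub computable_pow2 : computable.

Definition computableb (P : list nat -> bool) : Prop :=
  computable (fun l => Nat.b2n (P l)).

Lemma computable_if P f g :
  computableb P -> computable f -> computable g ->
  computable (fun l => if P l then f l else g l).
Proof.
  intros HP Hf Hg. apply (computable_ext (fun l => Nat.b2n (P l) * f l + (1 - Nat.b2n (P l)) * g l)).
  - intros l. destruct (P l); simpl; lia.
  - unfold computableb in HP. compu.
Qed.

Lemma computableb_ltb f g :
  computable f -> computable g -> computableb (fun l => f l <? g l).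
Proof.
  intros Hf Hg. apply (computable_ext (fun l => 1 - (S (f l) - g l))); compu.
  destruct (Nat.ltb_spec (f l) (g l)); cbn [Nat.b2n]; lia.
Qed.

Lemma computableb_eqb f g :
  computable f -> computable g -> computableb (fun l => f l =? g l).
Proof.
  intros Hf Hg.
  apply (computable_ext (fun l => 1 - ((f l - g l) + (g l - f l)))); compu.
  destruct (Nat.eqb_spec (f l) (g l)); cbn [Nat.b2n]; lia.
Qed.

Lemma computableb_andb P Q :
  computableb P -> computableb Q -> computableb (fun l => P l && Q l).
Proof.
  unfold computableb. intros HP HQ.
  apply (computable_ext (fun l => Nat.b2n (P l) * Nat.b2n (Q l))); compu.
  destruct (P l), (Q l); auto.
Qed.

Lemma computableb_negb P : computableb P -> computableb (fun l => negb (P l)).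
Proof.
  unfold computableb. intros HP.
  apply (computable_ext (fun l => 1 - Nat.b2n (P l))); compu.
  destruct (P l); auto.
Qed.

Lemma computableb_eqbool P Q :
  computableb P -> computableb Q -> computableb (fun l => eqb (P l) (Q l)).
Proof.
  unfold computableb. intros HP HQ.
  refine (computable_ext _ _ _ (computableb_eqb _ _ HP HQ)).
  intros l. now destruct (P l), (Q l).
Qed.

(** Position 1 of the environment is the accumulator of the underlying recursion, hence
    [skipn 2]. *)
Lemma computableb_forallb (P : nat -> list nat -> bool) b :
  computableb (fun l => P (nth 0 l 0) (skipn 2 l)) -> computable b ->
  computableb (fun l => forallb (fun i => P i l) (seq 0 (b l))).
Proof.
  unfold computableb. intros HP Hb.
  refine (computable_ext _ _ _ (computable_rec (fun l => 1) b
            (fun n r l => r * Nat.b2n (P n l)) _ _ _)); compu.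
  induction (b l) as [|n IH]; auto.
  rewrite seq_S, forallb_app. simpl. rewrite IH.
  destruct (forallb _ _), (P n l); auto.
Qed.

Lemma computableb_testbit f g :
  computable f -> computable g -> computableb (fun l => Nat.testbit (f l) (g l)).
Proof.
  intros Hf Hg.
  assert (Odd : computable1 (fun n => Nat.b2n (Nat.odd n))).
  { refine (computable_ext _ _ _ (computable_rec (fun l => 0) (fun l => nth 0 l 0)
              (fun _ r _ => 1 - r) _ _ _)); compu.
    induction (nth 0 l 0) as [|n IH]; auto. cbn [nat_rect]. rewrite IH.
    rewrite Nat.odd_succ, <- Nat.negb_odd. now destruct (Nat.odd n). }
  assert (Div2 : computable1 Nat.div2).
  { refine (computable_ext _ _ _ (computable_rec (fun l => 0) (fun l => nth 0 l 0)
              (fun n r _ => r + Nat.b2n (Nat.odd n)) _ _ _)); compu.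
    induction (nth 0 l 0) as [|n IH]; auto. cbn [nat_rect]. rewrite IH.
    pose proof (Nat.div2_odd n). pose proof (Nat.div2_odd (S n)).
    rewrite Nat.odd_succ, <- Nat.negb_odd in *. destruct (Nat.odd n); simpl in *; lia. }
  apply (computable_app2 (fun a k => Nat.b2n (Nat.testbit a k))); auto.
  refine (computable_ext _ _ _ (computable_app1 (fun n => Nat.b2n (Nat.odd n)) _ Odd
    (computable_rec (fun l => nth 0 l 0) (fun l => nth 1 l 0)
            (fun _ r _ => Nat.div2 r) _ _ _))); compu.
  - set (H := fun a n => nat_rect (fun _ => nat) a (fun _ r => Nat.div2 r) n).
    assert (HS : forall n a, H a (S n) = H (Nat.div2 a) n).
    { induction n as [|n IH]; intros a; auto.
      change (Nat.div2 (H a (S n)) = Nat.div2 (H (Nat.div2 a) n)). now rewrite IH. }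
    fold (H (nth 0 l 0) (nth 1 l 0)).
    generalize (nth 0 l 0). induction (nth 1 l 0) as [|n IH]; intros a; auto.
    rewrite HS, IH. now rewrite Nat.div2_div, Nat.div2_bits.
  - apply (computable_app1 Nat.div2); compu.
Qed.
#[export] Hint Resolve computable_if computableb_ltb computableb_eqb computableb_andb
  computableb_negb computableb_eqbool computableb_testbit : computable.

Lemma computable_mu_env (f : nat -> list nat -> nat) g :
  computable (fun l => f (nth 0 l 0) (skipn 1 l)) ->
  (forall l, least_zero (fun i => f i l) (g l)) -> computable g.
Proof. intros Hf Hg. exact (computable_mu _ g Hf Hg). Qed.

(** * Simulation of oracle machines on finitely coded oracles *)

Definition agree (m : nat) (x y : nat -> bool) : Prop := forall j, j < m -> x j = y j.

Lemma agree_sym m x y : agree m x y -> agree m y x.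
Proof. intros H j Hj. symmetry. auto. Qed.

Lemma agree_trans m x y z : agree m x y -> agree m y z -> agree m x z.
Proof. intros H1 H2 j Hj. rewrite H1; auto. Qed.

Lemma agree_le m n x y : m <= n -> agree n x y -> agree m x y.
Proof. intros H1 H2 j Hj. apply H2. lia. Qed.

(* Binary digits [x 0 .. x (m-1)], least significant first, below those of [b]. *)
Fixpoint code (b : nat) (x : nat -> bool) (m : nat) : nat :=
  match m with
  | 0 => b
  | S m => Nat.b2n (x 0) + 2 * code b (fun j => x (S j)) m
  end.

Lemma code_agree b x m : agree m (Nat.testbit (code b x m)) x.
Proof.
  revert x. induction m as [|m IH]; intros x j Hj; [lia|]. cbn [code].
  destruct j as [|j].
  - apply Nat.add_b2n_double_bit0.
  - rewrite <- Nat.div2_bits, Nat.add_b2n_double_div2. apply (IH (fun j => x (S j))). lia.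
Qed.

Lemma code0_lt x m : code 0 x m < 2 ^ m.
Proof.
  revert x. induction m as [|m IH]; intros x; [simpl; lia|].
  cbn [code Nat.pow]. specialize (IH (fun j => x (S j))). destruct (x 0); cbn [Nat.b2n]; lia.
Qed.

(** With leading digit 1 the code of a string exceeds its length, so the code can double as a time
    bound. *)
Lemma code1_gt x m : m < code 1 x m.
Proof.
  revert x. induction m as [|m IH]; intros x; [simpl; lia|].
  cbn [code]. specialize (IH (fun j => x (S j))). lia.
Qed.

(** Recursion at the most significant end leaves the oracle unshifted, as primitive recursion over
    the bits requires. *)
Lemma code0_S x m : code 0 x (S m) = code 0 x m + Nat.b2n (x m) * 2 ^ m.
Proof.
  revert x. induction m as [|m IH]; intros x; [simpl; lia|].
  change (code 0 x (S (S m))) with (Nat.b2n (x 0) + 2 * code 0 (fun j => x (S j)) (S m)).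
  rewrite IH. cbn [code Nat.pow]. lia.
Qed.

(* The second clause suffices because, by the first, finitely many bits of the
   oracle determine each output bit. *)
Definition functional (G : (nat -> bool) -> nat -> bool) : Prop :=
  (forall m x y, agree m x y -> agree m (G x) (G y)) /\
  computableb (fun l => G (Nat.testbit (nth 0 l 0)) (nth 1 l 0)).

Lemma functional_app G f g :
  functional G -> computable f -> computable g ->
  computableb (fun l => G (Nat.testbit (f l)) (g l)).
Proof.
  intros [_ HG] Hf Hg.
  exact (computable_app2 (fun c k => Nat.b2n (G (Nat.testbit c) k)) f g HG Hf Hg).
Qed.

Lemma functional_id : functional (fun x => x).
Proof. split; auto. compu. Qed.

Lemma functional_comp G D :
  functional G -> functional D -> functional (fun x => G (D x)).
Proof.
  intros HG HD. split.
  - intros m x y H. apply HG, HD, H.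
  (* Bit [k] of [G (D x)] needs only the first [k + 1] bits of [D x], which [cd] packs into a
     number. *)
  - set (cd := fun c m => code 0 (D (Nat.testbit c)) m).
    assert (Hcd : computable2 cd).
    { refine (computable_ext _ _ _ (computable_rec (fun l => 0) (fun l => nth 1 l 0)
        (fun n r l => r + Nat.b2n (D (Nat.testbit (nth 0 l 0)) n) * 2 ^ n) _ _ _)); compu.
      - unfold cd. generalize (nth 1 l 0). induction n as [|n IH]; auto.
        cbn [nat_rect]. now rewrite IH, code0_S.
      - apply computable_add; compu. apply computable_mul; compu.
        apply functional_app; compu. }
    assert (H : computableb (fun l => G (Nat.testbit (cd (nth 0 l 0) (S (nth 1 l 0)))) (nth 1 l 0))).
    { apply functional_app; compu. apply (computable_app2 cd); compu. }
    unfold computableb in *. refine (computable_ext _ _ _ H). intros l. f_equal.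
    apply (proj1 HG (S (nth 1 l 0))); auto. apply code_agree.
Qed.

(** * Simulation of register machines by iterated steps *)

Definition mstep (p : prog) (X : nat -> bool) (c : nat * (nat -> nat)) :=
  let (pc, s) := c in
  match nth_error p pc with
  | None => c
  | Some (Inc r) => (S pc, upd s r (S (s r)))
  | Some (JzDec r j) =>
      if Nat.eqb (s r) 0 then (j, s) else (S pc, upd s r (pred (s r)))
  | Some (Orac r) => (S pc, upd s r (if X (s r) then 1 else 0))
  end.

(** [mstep] stays put once halted, so running becomes plain iteration. The extra unit of fuel is
    what [run] spends on noticing the halt. *)
Lemma run_iter p X k pc s :
  run (S k) p X pc s =
  let c := Nat.iter k (mstep p X) (pc, s) in
  if fst c <? length p then None else Some (snd c).
Proof.
  revert pc s. induction k as [|k IH]; intros pc s.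
  - simpl. destruct (Nat.ltb_spec pc (length p)) as [H|H].
    + apply nth_error_Some in H. destruct (nth_error p pc) as [[r|r j|r]|]; auto; [|easy].
      now destruct (Nat.eqb (s r) 0).
    + apply nth_error_None in H. now rewrite H.
  - rewrite Nat.iter_succ_r. remember (S k) as k'. cbn [run mstep]. subst k'.
    destruct (nth_error p pc) as [[r|r j|r]|] eqn:E.
    + apply IH.
    + destruct (Nat.eqb (s r) 0); apply IH.
    + apply IH.
    + rewrite <- IH. simpl. now rewrite E.
Qed.

Definition instr_reg (i : instr) : nat :=
  match i with Inc r => r | JzDec r _ => r | Orac r => r end.

Section Simulation.

Variables (p : prog) (G : (nat -> bool) -> nat -> bool).
Hypothesis HG : functional G.

(** The successor makes the bound strict and keeps the output register 0 in the state even for the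
    empty program. *)
Let R := S (list_max (map instr_reg p)).

(* A configuration is the list [pc, reg 0, .., reg (R-1)]; the oracle code follows it. *)
Definition next_pc (i : instr) (l : list nat) : nat :=
  match i with
  | JzDec r j => if nth (S r) l 0 =? 0 then j else S (nth 0 l 0)
  | _ => S (nth 0 l 0)
  end.

Definition next_reg (k : nat) (i : instr) (l : list nat) : nat :=
  if k =? instr_reg i then
    match i with
    | Inc r => S (nth (S r) l 0)
    | JzDec r _ => pred (nth (S r) l 0)
    | Orac r => Nat.b2n (G (Nat.testbit (nth (S R) l 0)) (nth (S r) l 0))
    end
  else nth (S k) l 0.

(** The program is fixed, so instruction lookup is a finite nest of tests on the program counter and
    needs no coding of programs. *)
Fixpoint dispatch (h : instr -> list nat -> nat) (dflt : list nat -> nat)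
    (j : nat) (q : prog) (l : list nat) : nat :=
  match q with
  | [] => dflt l
  | i :: q => if nth 0 l 0 =? j then h i l else dispatch h dflt (S j) q l
  end.

Lemma computable_dispatch h dflt j q :
  (forall i, computable (h i)) -> computable dflt -> computable (dispatch h dflt j q).
Proof.
  intros Hh Hd. revert j. induction q as [|i q IH]; intros j; auto.
  cbn [dispatch]. apply computable_if; auto with computable.
Qed.

Lemma dispatch_spec h dflt q l :
  dispatch h dflt 0 q l =
  match nth_error q (nth 0 l 0) with Some i => h i l | None => dflt l end.
Proof.
  assert (E : forall j, j <= nth 0 l 0 -> dispatch h dflt j q l =
    match nth_error q (nth 0 l 0 - j) with Some i => h i l | None => dflt l end).
  { induction q as [|i q IH]; intros j Hj; cbn [dispatch].
    - now destruct (nth 0 l 0 - j).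
    - destruct (Nat.eqb_spec (nth 0 l 0) j) as [<-|N].
      + now rewrite Nat.sub_diag.
      + rewrite IH by lia. now replace (nth 0 l 0 - j) with (S (nth 0 l 0 - S j)) by lia. }
  rewrite E by lia. now rewrite Nat.sub_0_r.
Qed.

Definition machine_steps : list (list nat -> nat) :=
  dispatch next_pc (fun l => nth 0 l 0) 0 p ::
  map (fun k => dispatch (next_reg k) (fun l => nth (S k) l 0) 0 p) (seq 0 R).

Lemma computable_machine_steps : Forall computable machine_steps.
Proof.
  constructor.
  - apply computable_dispatch; [|compu].
    intros [r|r j|r]; unfold next_pc; compu.
  - apply Forall_forall. intros f If. apply in_map_iff in If as (k & <- & _).
    apply computable_dispatch; [|compu].
    intros i. unfold next_reg. destruct (k =? instr_reg i); [|compu].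
    destruct i; try solve [compu]. apply functional_app; compu.
Qed.

Definition represents (st : list nat) (c : nat * (nat -> nat)) : Prop :=
  length st = S R /\ nth 0 st 0 = fst c /\
  forall r, r < R -> nth (S r) st 0 = snd c r.

Lemma nth_map_seq (h : nat -> nat) n i d : i < n -> nth i (map h (seq 0 n)) d = h i.
Proof.
  intros H. rewrite nth_indep with (d' := h 0) by (now rewrite length_map, length_seq).
  rewrite map_nth, seq_nth; auto.
Qed.

Lemma represents_step st c l :
  represents st c ->
  represents (step_list machine_steps l st)
             (mstep p (G (Nat.testbit (nth 0 l 0))) c).
Proof.
  destruct c as [pc s]. intros (L & Hpc & Hr). simpl in Hpc, Hr.
  set (l' := st ++ l).
  assert (P' : nth 0 l' 0 = pc) by (unfold l'; rewrite app_nth1; auto; lia).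
  assert (R' : forall r, r < R -> nth (S r) l' 0 = s r)
    by (intros r H; unfold l'; rewrite app_nth1; auto; lia).
  assert (C' : nth (S R) l' 0 = nth 0 l 0)
    by (unfold l'; rewrite app_nth2 by lia; f_equal; lia).
  assert (B : forall i, nth_error p pc = Some i -> instr_reg i < R).
  { intros i Hi. apply nth_error_In in Hi. unfold R.
    apply Nat.lt_succ_r. assert (Q := list_max_le (map instr_reg p) (list_max (map instr_reg p))).
    destruct Q as [Q _]. specialize (Q (le_n _)). rewrite Forall_forall in Q.
    apply Q. now apply in_map. }
  unfold step_list, machine_steps. fold l'.
  split; [|split].
  - simpl. now rewrite !length_map, length_seq.
  - cbn [map nth]. fold l'. rewrite dispatch_spec, P'. cbn [mstep].
    destruct (nth_error p pc) as [[r|r j|r]|] eqn:E; cbn [next_pc fst]; auto.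
    rewrite R' by (apply (B _ eq_refl)). rewrite P'.
    now destruct (s r =? 0).
  - intros k Hk. cbn [map nth]. rewrite map_map, nth_map_seq by auto. fold l'.
    rewrite dispatch_spec, P'. cbn [mstep].
    destruct (nth_error p pc) as [i|] eqn:E; [|now apply R'].
    specialize (B i eq_refl). unfold next_reg.
    destruct i as [r|r j|r]; simpl in B; cbn [instr_reg];
      destruct (Nat.eqb_spec k r) as [->|N]; rewrite ?C', ?R' by auto;
      try (destruct (Nat.eqb_spec (s r) 0) as [Z|Z]); cbn [snd];
      rewrite ?upd_same, ?upd_other by auto; auto.
    all: try (now rewrite Z).
Qed.

(** 0 stands for not yet halted, and [S y] for output [y]. *)
Definition sim (c n t : nat) : nat :=
  match run (S t) p (G (Nat.testbit c)) 0 (init [n]) with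
  | Some s => S (s 0)
  | None => 0
  end.

Lemma computable_sim : computable3 sim.
Proof.
  set (inits := (fun _ => 0) ::
         map (fun r (l : list nat) => init [nth 1 l 0] r) (seq 0 R)).
  assert (Hi : Forall computable inits).
  { constructor; [compu|].
    apply Forall_forall. intros f If. apply in_map_iff in If as (k & <- & _).
    destruct k as [|k]; [unfold init; simpl; compu|].
    refine (computable_ext _ _ _ (computable_const 0)). intros l. now destruct k. }
  assert (HL : length inits = length machine_steps).
  { simpl. now rewrite !length_map. }
  set (st := fun l => Nat.iter (nth 2 l 0) (step_list machine_steps l)
                        (map (fun f => f l) inits)).
  assert (Hst : forall j, computable (fun l => nth j (st l) 0)).
  { intros j. apply (computable_iter machine_steps inits (fun l => nth 2 l 0) j); auto.
    - apply computable_machine_steps.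
    - compu. }
  apply (computable_ext (fun l => if nth 0 (st l) 0 <? length p then 0
                                  else S (nth 1 (st l) 0))).
  - intros l. unfold sim. rewrite run_iter.
    assert (Q : represents (st l) (Nat.iter (nth 2 l 0)
              (mstep p (G (Nat.testbit (nth 0 l 0)))) (0, init [nth 1 l 0]))).
    { unfold st. induction (nth 2 l 0) as [|t IH]; [|now apply represents_step].
      split; [|split]; auto.
      - simpl. now rewrite !length_map, length_seq.
      - intros r Hr. unfold inits. cbn [Nat.iter nat_rect snd map].
        rewrite map_map. exact (nth_map_seq (init [nth 1 l 0]) R r 0 Hr). }
    destruct Q as (_ & -> & Q2). rewrite (Q2 0) by (unfold R; lia). cbv zeta.
    now destruct (fst _ <? length p).
  - apply computable_if; auto with computable.
Qed.

End Simulation.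

(** A step raises the bound on the registers by at most 1, so all queries made within [k] steps lie
    below [B + k]. *)
Lemma run_use p X Y k pc s B u :
  (forall r, s r <= B) -> B + k <= u -> agree u X Y ->
  run k p X pc s = run k p Y pc s.
Proof.
  revert pc s B. induction k as [|k IH]; intros pc s B Hs Hu HA; auto.
  cbn [run]. destruct (nth_error p pc) as [[r|r j|r]|]; auto.
  - apply IH with (S B); [|lia|auto]. intros i. unfold upd.
    destruct (i =? r); specialize (Hs r) as H1; specialize (Hs i) as H2; lia.
  - destruct (s r =? 0).
    + apply IH with B; [auto|lia|auto].
    + apply IH with B; [|lia|auto]. intros i. unfold upd.
      destruct (i =? r); specialize (Hs r) as H1; specialize (Hs i) as H2; lia.
  - rewrite (HA (s r)) by (specialize (Hs r); lia).
    apply IH with (S B); [|lia|auto]. intros i. unfold upd.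
    destruct (i =? r), (Y (s r)); specialize (Hs i); lia.
Qed.

Lemma run_init_use p X Y k n u :
  n + k <= u -> agree u X Y -> run k p X 0 (init [n]) = run k p Y 0 (init [n]).
Proof.
  apply run_use with (B := n). intros [|[|r]]; unfold init; simpl; lia.
Qed.

(** * Forcing divergence or a small trace *)

Lemma conv_unique p X n y1 y2 : conv p X n y1 -> conv p X n y2 -> y1 = y2.
Proof.
  intros (k1 & s1 & H1 & <-) (k2 & s2 & H2 & <-).
  apply run_mono with (m := k2) in H1. apply run_mono with (m := k1) in H2.
  rewrite Nat.add_comm in H2. congruence.
Qed.

Definition injective_real (D : (nat -> bool) -> nat -> bool) : Prop :=
  forall x y, (forall k, D x k = D y k) -> forall k, x k = y k.

Section Forcing.

Variables (p : prog) (G : (nat -> bool) -> nat -> bool).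
Hypothesis HG : functional G.
Hypothesis dense : forall x m n,
  exists z, agree m x z /\ exists y, conv p (G z) n y.

(** Inputs are handled one at a time; each extension preserves the use of the computations already
    found. The one number [M] bounds both use and time. *)
Lemma dense_initial N x m :
  exists z M, agree m x z /\ forall z' t n, agree M z z' -> M <= t -> n < N ->
    run (S t) p (G z') 0 (init [n]) <> None.
Proof.
  revert x m. induction N as [|N IH]; intros x m.
  - exists x, 0. split; [now intros j|lia].
  - destruct (IH x m) as (z1 & M1 & A1 & H1).
    destruct (dense z1 (Nat.max m M1) N) as (z & A & y & k & s & Hk & _).
    (* A run of [k] steps on input [N] queries only positions below [N + k]. *)
    exists z, (Nat.max M1 (N + k)). split.
    + intros j Hj. rewrite A1 by auto. apply A. lia.
    + intros z' t n A' Ht Hn. destruct (Nat.eq_dec n N) as [->|Hne].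
      * replace (S t) with (k + (S t - k)) by lia.
        rewrite run_mono with (s' := s); [discriminate|].
        rewrite <- Hk. symmetry. apply run_init_use with (N + k); auto.
        apply HG. apply agree_le with (2 := A'). lia.
      * apply H1; try lia. apply agree_trans with z.
        -- apply agree_le with (2 := A). lia.
        -- apply agree_le with (2 := A'). lia.
Qed.

(** [a'] is both the oracle string and the time bound, so a search over one number finds both. The
    node built here lies after [l + 1] branchings and must settle every input with
    [log2 n <= l + 1], that is, below [2 ^ (l + 2)]. *)
Definition extends (a' l i a m : nat) : bool :=
  forallb (fun j => eqb (Nat.testbit a' j) (Nat.testbit a j)) (seq 0 m) &&
  eqb (Nat.testbit a' m) (0 <? i) &&
  forallb (fun n => 0 <? sim p G a' n a') (seq 0 (2 ^ (l + 2))).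

Lemma extends_exists l i a m : exists a', extends a' l i a m = true.
Proof.
  set (x := fun j => if j <? m then Nat.testbit a j else 0 <? i).
  destruct (dense_initial (2 ^ (l + 2)) x (S m)) as (z & M & A & H).
  set (K := Nat.max M (S m)).
  (* The digit 1 above the [K] bits of [z] makes this number larger than [M], hence a sufficient
     time bound. *)
  exists (code 1 z K).
  pose proof (code_agree 1 z K) as C. pose proof (code1_gt z K) as L.
  assert (B : forall j, j < S m -> Nat.testbit (code 1 z K) j = x j).
  { intros j Hj. rewrite C by lia. symmetry. auto. }
  unfold extends. rewrite !andb_true_iff, !forallb_forall. repeat split.
  - intros j Hj. apply in_seq in Hj. rewrite B by lia. unfold x.
    rewrite (proj2 (Nat.ltb_lt j m)) by lia. apply eqb_reflx.
  - rewrite B by lia. unfold x. rewrite Nat.ltb_irrefl. apply eqb_reflx.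
  - intros n Hn. apply in_seq in Hn. unfold sim.
    specialize (H (Nat.testbit (code 1 z K)) (code 1 z K) n).
    destruct (run _ _ _ _ _); auto.
    exfalso. apply H; auto; [|lia|lia].
    apply agree_sym, agree_le with (2 := C). lia.
Qed.

(** Taking the least extension makes the choice a minimization, hence computable. *)
Lemma extension_function :
  exists ext, computable4 ext /\ forall l i a m, extends (ext l i a m) l i a m = true.
Proof.
  assert (S0 : forall l i a m, {a' | extends a' l i a m = true /\
                 forall b, extends b l i a m = true -> a' <= b}).
  { intros l i a m. apply epsilon_smallest.
    - intros a'. destruct (extends a' l i a m); auto.
    - apply extends_exists. }
  exists (fun l i a m => proj1_sig (S0 l i a m)). split.
  - apply (computable_mu_env (fun a' v => 1 - Nat.b2n
      (extends a' (nth 0 v 0) (nth 1 v 0) (nth 2 v 0) (nth 3 v 0)))).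
    + apply computable_sub; [compu|]. unfold extends.
      change (computableb (fun v =>
        forallb (fun j => eqb (Nat.testbit (nth 0 v 0) j)
                 (Nat.testbit (nth 2 (skipn 1 v) 0) j)) (seq 0 (nth 3 (skipn 1 v) 0)) &&
        eqb (Nat.testbit (nth 0 v 0) (nth 3 (skipn 1 v) 0)) (0 <? nth 1 (skipn 1 v) 0) &&
        forallb (fun n => 0 <? sim p G (nth 0 v 0) n (nth 0 v 0))
           (seq 0 (2 ^ (nth 0 (skipn 1 v) 0 + 2))))).
      apply computableb_andb; [apply computableb_andb|].
      * apply (computableb_forallb (fun j v => eqb (Nat.testbit (nth 0 v 0) j)
                 (Nat.testbit (nth 2 (skipn 1 v) 0) j))); [|compu].
        apply computableb_eqbool; apply computableb_testbit; try solve [compu].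
        apply (computable_skipn (fun v => nth 2 (skipn 1 v) 0)). compu.
      * apply computableb_eqbool; compu.
      * apply (computableb_forallb (fun n v => 0 <? sim p G (nth 0 v 0) n (nth 0 v 0)));
          [|compu].
        apply computableb_ltb; [compu|].
        apply (computable_app3 (sim p G)); compu. now apply computable_sim.
    + intros v. destruct (S0 (nth 0 v 0) (nth 1 v 0) (nth 2 v 0) (nth 3 v 0)) as (a1 & H1 & H2).
      cbn [proj1_sig]. split.
      * now rewrite H1.
      * intros b Hb E. destruct (extends b _ _ _ _) eqn:F; [|discriminate].
        apply H2 in F. lia.
  - intros l i a m. exact (proj1 (proj2_sig (S0 l i a m))).
Qed.

Section Tree.

Variable ext : nat -> nat -> nat -> nat -> nat.
Hypothesis computable_ext4 : computable4 ext.
Hypothesis ext_extends : forall l i a m, extends (ext l i a m) l i a m = true.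

(* The node reached after [l] branchings: a code of the string and its length,
   the length exceeding the use of all computations decided so far. *)
Fixpoint node (z : nat -> bool) (l : nat) : nat * nat :=
  match l with
  | 0 => (0, 0)
  | S l => let (a, m) := node z l in
           let a' := ext l (Nat.b2n (z l)) a m in
           (a', m + S (2 ^ (l + 2) + a'))
  end.

Let str z l := fst (node z l).
Let len z l := snd (node z l).

Lemma len_S z l : len z (S l) = len z l + S (2 ^ (l + 2) + str z (S l)).
Proof. unfold len, str. cbn [node]. now destruct (node z l). Qed.

Lemma node_step z l :
  agree (len z l) (Nat.testbit (str z (S l))) (Nat.testbit (str z l)) /\
  Nat.testbit (str z (S l)) (len z l) = z l /\
  forall n, n < 2 ^ (l + 2) -> 0 < sim p G (str z (S l)) n (str z (S l)).
Proof.
  unfold len, str. cbn [node]. destruct (node z l) as [a m]. cbn [fst snd].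
  specialize (ext_extends l (Nat.b2n (z l)) a m) as E. unfold extends in E.
  rewrite !andb_true_iff, !forallb_forall in E. destruct E as [[E1 E2] E3].
  split; [|split].
  - intros j Hj. apply eqb_prop, E1, in_seq. lia.
  - apply eqb_prop in E2. rewrite E2. now destruct (z l).
  - intros n Hn. apply Nat.ltb_lt, E3, in_seq. lia.
Qed.

Lemma node_agree l x y : agree l x y -> node x l = node y l.
Proof.
  induction l as [|l IH]; intros H; auto. cbn [node].
  rewrite IH by (apply agree_le with (2 := H); lia). now rewrite H by lia.
Qed.

Lemma le_len z l : l <= len z l.
Proof. induction l as [|l IH]; [lia|]. rewrite len_S. lia. Qed.

Lemma str_agree z l l' :
  l <= l' -> agree (len z l) (Nat.testbit (str z l')) (Nat.testbit (str z l)).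
Proof.
  intros H.
  assert (Q : len z l <= len z l' /\
    agree (len z l) (Nat.testbit (str z l')) (Nat.testbit (str z l))).
  { induction H as [|l' H [IH1 IH2]]; [split; auto; now intros j|].
    split; [rewrite len_S; lia|].
    apply agree_trans with (Nat.testbit (str z l')); auto.
    apply agree_le with (1 := IH1). apply node_step. }
  apply Q.
Qed.

(** The node after [S k] branchings is longer than [k], so bit [k] is final there. It depends on
    only [k + 1] bits of [z], so [branch] is nonexpanding. *)
Definition branch (z : nat -> bool) (k : nat) : bool := Nat.testbit (str z (S k)) k.

Lemma branch_agree z l : agree (len z l) (branch z) (Nat.testbit (str z l)).
Proof.
  intros k Hk. unfold branch. destruct (Nat.le_ge_cases l (S k)) as [H|H].
  - now apply str_agree.
  - symmetry. apply str_agree with (1 := H). pose proof (le_len z (S k)). lia.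
Qed.

Lemma branch_len z l : branch z (len z l) = z l.
Proof.
  destruct (node_step z l) as (_ & <- & _). apply branch_agree. rewrite len_S. lia.
Qed.

(** The bit [z k] can be read off at position [len z k], which depends only on the earlier bits of
    [z]. *)
Lemma branch_injective : injective_real branch.
Proof.
  intros x y H k. induction k as [k IH] using lt_wf_ind.
  rewrite <- (branch_len x k), H. unfold len at 1.
  rewrite (node_agree k x y IH). apply branch_len.
Qed.

Lemma computable_str : computable2 (fun c l => str (Nat.testbit c) l).
Proof.
  set (e := fun v => ext (nth 0 v 0) (Nat.b2n (Nat.testbit (nth 3 v 0) (nth 0 v 0)))
                         (nth 1 v 0) (nth 2 v 0)).
  assert (He : computable e).
  { apply computable_app4; compu. apply computableb_testbit; compu. }
  set (ss := [(fun v => S (nth 0 v 0)); e;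
              (fun v => nth 2 v 0 + S (2 ^ (nth 0 v 0 + 2) + e v))]).
  set (zs := [(fun _ => 0); (fun _ => 0); (fun _ => 0)] : list (list nat -> nat)).
  refine (computable_ext _ _ _ (computable_iter ss zs (fun v => nth 1 v 0) 1 _ _ eq_refl _)).
  - intros v. generalize (nth 1 v 0) as l. intros l.
    assert (E : Nat.iter l (step_list ss v) (map (fun f => f v) zs) =
      [l; str (Nat.testbit (nth 0 v 0)) l; len (Nat.testbit (nth 0 v 0)) l]).
    { induction l as [|l IH]; auto. rewrite Nat.iter_succ, IH.
      unfold str at 2, len at 2. cbn [node].
      unfold str, len. now destruct (node (Nat.testbit (nth 0 v 0)) l). }
    now rewrite E.
  - repeat constructor; compu.
  - repeat constructor; compu.
  - compu.
Qed.

Lemma functional_branch : functional branch.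
Proof.
  split.
  - intros m x y H k Hk. unfold branch, str. rewrite (node_agree (S k) x y); auto.
    apply agree_le with (2 := H). lia.
  - apply computableb_testbit; [|compu].
    apply (computable_app2 (fun c l => str (Nat.testbit c) l)); compu.
    apply computable_str.
Qed.

Lemma node_value z l n :
  n < 2 ^ S l -> 0 < l ->
  exists y, sim p G (str z l) n (str z l) = S y /\
    forall X, agree (len z l) X (Nat.testbit (str z l)) -> conv p (G X) n y.
Proof.
  destruct l as [|l]; [lia|]. intros Hn _.
  destruct (node_step z l) as (_ & _ & H).
  replace (2 ^ S (S l)) with (2 ^ (l + 2)) in Hn by (f_equal; lia).
  specialize (H n Hn). unfold sim in *.
  destruct (run _ _ _ _ _) as [s|] eqn:E; [|lia].
  exists (s 0). split; auto. intros X HX.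
  exists (S (str z (S l))), s. split; auto. rewrite <- E.
  (* The summand [S (2 ^ (l + 2) + a')] in the length of a node was chosen to cover this use. *)
  apply run_init_use with (n + S (str z (S l))); auto.
  apply HG. apply agree_le with (2 := HX). rewrite len_S. lia.
Qed.

(* For [2^l <= n < 2^(l+1)] the value at [n] is decided after [l] branchings, so
   the at most [n] codes [c < n] produce all of its values. *)
Lemma branch_traced :
  exists V, (forall n, card_le (ucemem V n) n) /\
    forall z n y, 2 <= n -> conv p (G (branch z)) n y -> ucemem V n y.
Proof.
  (* The path of [c] is followed for [n] rather than [log2 n] branchings, which spares computing the
     logarithm; longer strings keep the value already decided. *)
  set (val := fun c n => sim p G (str (Nat.testbit c) n) n (str (Nat.testbit c) n)).
  assert (Hval : computable2 val).
  { pose proof computable_str as Hs.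
    apply (computable_app3 (sim p G)); compu. now apply computable_sim. }
  destruct (computable_decides_ucemem (fun v => Nat.b2n
    (forallb (fun c => negb (val c (nth 0 v 0) =? S (nth 1 v 0))) (seq 0 (nth 0 v 0)))))
    as [V HV].
  { apply (computableb_forallb
      (fun c v => negb (val c (nth 0 v 0) =? S (nth 1 v 0)))); [|compu].
    apply computableb_negb, computableb_eqb; [|compu].
    apply (computable_app2 val); compu. }
  assert (HV' : forall n y, ucemem V n y <-> exists c, c < n /\ val c n = S y).
  { intros n y. rewrite HV. cbn [nth].
    destruct (forallb _ _) eqn:E; split.
    - discriminate.
    - intros (c & Hc & Hy). rewrite forallb_forall in E.
      specialize (E c). rewrite in_seq in E. specialize (E ltac:(lia)).
      rewrite Hy, Nat.eqb_refl in E. discriminate.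
    - intros _. apply not_true_iff_false in E. apply NNPP. intros N. apply E.
      apply forallb_forall. intros c Hc. apply in_seq in Hc.
      destruct (Nat.eqb_spec (val c n) (S y)); auto.
      exfalso. apply N. exists c. split; [lia|auto].
    - auto. }
  exists V. split.
  - intros n. exists (map (fun c => pred (val c n)) (seq 0 n)). split.
    + now rewrite length_map, length_seq.
    + intros y Hy. apply HV' in Hy as (c & Hc & Hy).
      apply in_map_iff. exists c. rewrite Hy. split; auto. apply in_seq. lia.
  - intros z n y Hn Hy. apply HV'.
    set (l := Nat.log2 n).
    destruct (Nat.log2_spec n) as [L1 L2]; [lia|]. fold l in L1, L2.
    (* The root decides nothing, which is why [n] starts at 2. *)
    assert (L0 : 0 < l) by (apply Nat.log2_pos; lia).
    assert (Ln : l <= n) by (apply Nat.log2_le_lin; lia).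
    set (c := code 0 z l). exists c. split; [apply Nat.lt_le_trans with (1 := code0_lt z l); auto|].
    assert (En : node (Nat.testbit c) l = node z l) by apply node_agree, code_agree.
    destruct (node_value z l n L2 L0) as (y0 & _ & H0).
    destruct (node_value (Nat.testbit c) n n) as (y1 & E1 & H1); [|lia|].
    { apply Nat.lt_trans with (S n); [lia|]. apply Nat.pow_gt_lin_r. lia. }
    unfold val. rewrite E1. f_equal.
    (* The nodes of [c] and [z] coincide at level [l], so the value [y0] decided there is shared by
       the longer string of [c] and by the branch of [z]. *)
    transitivity y0.
    + apply conv_unique with p (G (Nat.testbit (str (Nat.testbit c) n))) n.
      * apply H1. now intros j.
      * apply H0. pose proof (str_agree (Nat.testbit c) l n Ln) as Q.
        unfold len, str in *. now rewrite En in Q.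
    + apply conv_unique with p (G (branch z)) n; auto.
      apply H0, branch_agree.
Qed.

End Tree.

Lemma dense_traced :
  exists D, functional D /\ injective_real D /\
  exists V, (forall n, card_le (ucemem V n) n) /\
    forall z n y, 2 <= n -> conv p (G (D z)) n y -> ucemem V n y.
Proof.
  destruct extension_function as (ext & He & Hx).
  exists (branch ext). split; [|split].
  - now apply functional_branch.
  - now apply branch_injective.
  - now apply branch_traced.
Qed.

End Forcing.

(** The real [x] may be noncomputable: only its first [m] bits enter, hard-wired as the number
    [c]. *)
Lemma functional_graft x m :
  functional (fun z k => if k <? m then x k else z (k - m)).
Proof.
  split.
  - intros n y z H k Hk. destruct (k <? m); auto. apply H. lia.
  - set (c := code 0 x m).
    assert (Q : computable (fun v => if nth 1 v 0 <? m
               then Nat.b2n (Nat.testbit c (nth 1 v 0))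
               else Nat.b2n (Nat.testbit (nth 0 v 0) (nth 1 v 0 - m)))).
    { apply computable_if; [compu|apply computableb_testbit; compu..]. }
    refine (computable_ext _ _ _ Q). intros v.
    destruct (Nat.ltb_spec (nth 1 v 0) m) as [H|H]; auto.
    unfold c. now rewrite code_agree.
Qed.

Definition cons_real (i : bool) (z : nat -> bool) (k : nat) : bool :=
  match k with 0 => i | S k => z k end.

Lemma functional_cons i : functional (cons_real i).
Proof.
  destruct (functional_graft (fun _ => i) 1) as [H1 H2].
  assert (E : forall z k, (if k <? 1 then i else z (k - 1)) = cons_real i z k).
  { intros z [|k]; auto. cbn. now rewrite Nat.sub_0_r. }
  split.
  - intros m x y H k Hk. rewrite <- !E. now apply (H1 m x y H).
  - refine (computable_ext _ _ _ H2). intros v. now rewrite <- E.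
Qed.

Lemma force_or_trace p G :
  functional G ->
  exists D, functional D /\ injective_real D /\
  ((forall z, ~ total p (G (D z))) \/
   exists V, (forall n, card_le (ucemem V n) n) /\
     forall z n y, 2 <= n -> conv p (G (D z)) n y -> ucemem V n y).
Proof.
  intros HG.
  destruct (classic (forall x m n, exists z, agree m x z /\ exists y, conv p (G z) n y))
    as [H|H].
  - destruct (dense_traced p G HG H) as (D & H1 & H2 & H3). exists D. auto.
  - apply not_all_ex_not in H as [x H]. apply not_all_ex_not in H as [m H].
    apply not_all_ex_not in H as [n H].
    (* The first [m] bits of [x] force divergence at [n]; the tree consists of all their
       extensions. *)
    exists (fun z k => if k <? m then x k else z (k - m)).
    split; [apply functional_graft|]. split.
    + intros y z E k. specialize (E (k + m)).
      rewrite (proj2 (Nat.ltb_ge (k + m) m)) in E by lia.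
      now rewrite Nat.add_sub in E.
    + left. intros z T. apply H. eexists. split; [|apply (T n)].
      intros j Hj. now rewrite (proj2 (Nat.ltb_lt j m)) by lia.
Qed.

(** * Fusion *)

Definition instr_code (i : instr) : nat :=
  match i with
  | Inc r => to_nat (0, to_nat (r, 0))
  | JzDec r j => to_nat (1, to_nat (r, j))
  | Orac r => to_nat (2, to_nat (r, 0))
  end.

Fixpoint prog_code (p : prog) : nat :=
  match p with
  | [] => 0
  | i :: p => S (to_nat (instr_code i, prog_code p))
  end.

Local Opaque to_nat.

Lemma instr_code_inj i j : instr_code i = instr_code j -> i = j.
Proof.
  destruct i, j; cbn [instr_code]; intros H; apply to_nat_inj in H;
    try discriminate; injection H as H; apply to_nat_inj in H; congruence.
Qed.

Lemma prog_code_inj p q : prog_code p = prog_code q -> p = q.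
Proof.
  revert q. induction p as [|i p IH]; intros [|j q] H; try discriminate; auto.
  injection H as H. apply to_nat_inj in H. injection H as H1 H2.
  apply instr_code_inj in H1. apply IH in H2. congruence.
Qed.

(** Decoding by choice suffices, since the order in which the functionals are treated need not be
    effective. *)
Lemma prog_enumeration : exists e : nat -> prog, forall p, exists n, e n = p.
Proof.
  destruct (functional_choice (fun n p => forall q, prog_code q = n -> q = p)) as [e He].
  - intros n. destruct (classic (exists p, prog_code p = n)) as [[p Hp]|H].
    + exists p. intros q Hq. apply prog_code_inj. congruence.
    + exists []. intros q Hq. exfalso. eauto.
  - exists e. intros p. exists (prog_code p). symmetry. auto.
Qed.

(** The constructed real equals a branch of each condition only pointwise; the use principle
    transfers computations without function extensionality. *)
Lemma conv_ext p X Y n y : (forall k, X k = Y k) -> conv p X n y -> conv p Y n y.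
Proof.
  intros H (k & s & Hk & Hs). exists k, s. split; auto. rewrite <- Hk. symmetry.
  apply run_init_use with (n + k); auto. intros j _. apply H.
Qed.

Section Fusion.

Variable e : nat -> prog.
Variable D : prog * ((nat -> bool) -> nat -> bool) -> (nat -> bool) -> nat -> bool.
Hypothesis D_functional : forall p G, functional G -> functional (D (p, G)).
Hypothesis D_injective : forall p G, functional G -> injective_real (D (p, G)).

Fixpoint condition (Z : nat -> bool) (n : nat) : (nat -> bool) -> nat -> bool :=
  match n with
  | 0 => fun z => z
  | S n => let G := condition Z n in fun z => G (D (e n, G) (cons_real (Z n) z))
  end.

Definition refine_condition Z n (z : nat -> bool) : nat -> bool :=
  D (e n, condition Z n) (cons_real (Z n) z).

Lemma functional_condition Z n : functional (condition Z n).
Proof.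
  induction n as [|n IH]; [apply functional_id|].
  apply (functional_comp (condition Z n)); auto.
  apply (functional_comp (D (e n, condition Z n))); auto.
  apply functional_cons.
Qed.

Lemma condition_injective Z n : injective_real (condition Z n).
Proof.
  induction n as [|n IH]; intros x y H; auto.
  intros k. apply IH, D_injective in H; [|apply functional_condition].
  exact (H (S k)).
Qed.

(** Leibniz equality matters: [D] is an arbitrary choice function, so only identical conditions are
    sure to receive identical refinements. *)
Lemma condition_agree n Z1 Z2 : agree n Z1 Z2 -> condition Z1 n = condition Z2 n.
Proof.
  induction n as [|n IH]; intros H; auto. cbn [condition].
  rewrite IH by (apply agree_le with (2 := H); lia). now rewrite H by lia.
Qed.

(** [D] loses no agreement, and the prepended bit [Z n] gains one position. *)
Lemma refine_condition_contracts Z n k x y :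
  agree k x y -> agree (S k) (refine_condition Z n x) (refine_condition Z n y).
Proof.
  intros H. apply D_functional; [apply functional_condition|].
  intros [|j] Hj; auto. apply H. lia.
Qed.

(** The refinements [n], ..., [n + k - 1] applied to an arbitrary seed, the zero real; by
    contraction the first [k] bits do not depend on the seed. *)
Fixpoint approx (Z : nat -> bool) (k n : nat) : nat -> bool :=
  match k with
  | 0 => fun _ => false
  | S k => refine_condition Z n (approx Z k (S n))
  end.

Definition limit Z n (j : nat) : bool := approx Z (S j) n j.

Lemma approx_agree Z k k' n : k <= k' -> agree k (approx Z k n) (approx Z k' n).
Proof.
  revert k' n. induction k as [|k IH]; intros k' n H; [now intros j Hj|].
  destruct k' as [|k']; [lia|].
  apply refine_condition_contracts, IH. lia.
Qed.

Lemma limit_agree Z k n : agree k (limit Z n) (approx Z k n).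
Proof. intros j Hj. apply (approx_agree Z (S j) k n); lia. Qed.

Lemma limit_step Z n j : limit Z n j = refine_condition Z n (limit Z (S n)) j.
Proof.
  apply (refine_condition_contracts Z n j); [|lia]. apply agree_sym, limit_agree.
Qed.

(** A single real thus lies in the image of every condition, so each functional is dealt with at its
    own stage. *)
Lemma limit_condition Z n j : limit Z 0 j = condition Z n (limit Z n) j.
Proof.
  induction n as [|n IH]; auto. rewrite IH.
  apply (proj1 (functional_condition Z n) (S j)); [|lia].
  intros i _. apply limit_step.
Qed.

Lemma limit_injective Z1 Z2 :
  (forall j, limit Z1 0 j = limit Z2 0 j) -> forall n, Z1 n = Z2 n.
Proof.
  intros H n. induction n as [n IH] using lt_wf_ind.
  assert (E : forall j, condition Z1 (S n) (limit Z1 (S n)) j =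
                        condition Z2 (S n) (limit Z2 (S n)) j)
    by (intros j; now rewrite <- !limit_condition).
  (* Equal earlier bits give the same condition and the same refinement; cancelling both injections
     leaves reals whose bit 0 is [Z1 n] and [Z2 n]. *)
  cbn [condition] in E. rewrite <- (condition_agree n Z1 Z2 IH) in E.
  apply condition_injective, D_injective in E; [|apply functional_condition].
  exact (E 0).
Qed.

End Fusion.

(** * Comparison of the trace bound with [h_eps] *)

Lemma iroot_aux_ge q m k j : j <= k -> j ^ q <= m -> j <= iroot_aux q m k.
Proof.
  intros H1 H2. induction k as [|k IH]; cbn [iroot_aux]; [lia|].
  destruct (Nat.leb_spec (S k ^ q) m); [lia|].
  apply IH. destruct (Nat.eq_dec j (S k)) as [->|]; lia.
Qed.

(** Since [n ^ q <= n ^ (q + p)], the number [n] is itself a candidate in the search for the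
    root. *)
Lemma le_h_eps p q n : 0 < q -> n <= h_eps p q n.
Proof.
  intros Hq. destruct n as [|n]; [lia|]. apply iroot_aux_ge.
  - rewrite <- (Nat.pow_1_r (S n)) at 1. apply Nat.pow_le_mono_r; lia.
  - apply Nat.pow_le_mono_r; lia.
Qed.

Lemma card_le_weaken U k k' : k <= k' -> card_le U k -> card_le U k'.
Proof. intros H (l & L & HU). exists l. split; [lia|auto]. Qed.

(* For every positive rational eps = p/q, there are continuum many
   h-jump traceable X in 2^omega, h(n) = floor(n^(1+eps)): witnessed by an
   (extensionally) injective map from 2^omega into the h-jump traceables. *)
Theorem mainTheorem9 (p q : nat) (hp : 0 < p) (hq : 0 < q) :
  exists f : (nat -> bool) -> (nat -> bool),
    (forall Z1 Z2 : nat -> bool,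
        (forall n, f Z1 n = f Z2 n) -> forall n, Z1 n = Z2 n) /\
    (forall Z : nat -> bool, jump_traceable (h_eps p q) (f Z)).
Proof.
  destruct prog_enumeration as [e He].
  destruct (functional_choice
    (fun (a : prog * ((nat -> bool) -> nat -> bool)) D =>
       functional (snd a) -> functional D /\ injective_real D /\
       ((forall z, ~ total (fst a) (snd a (D z))) \/
        exists V, (forall n, card_le (ucemem V n) n) /\
          forall z n y, 2 <= n -> conv (fst a) (snd a (D z)) n y -> ucemem V n y)))
    as [D HD].
  { intros [P G]. destruct (classic (functional G)) as [HG|HG].
    - destruct (force_or_trace P G HG) as [D HD]. exists D. auto.
    (* A default value: [D] must be total, also on pairs whose second component is not a
       functional. *)
    - exists (fun z => z). intros H. contradiction. }
  assert (D1 : forall P G, functional G -> functional (D (P, G)))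
    by (intros P G HG; apply (HD (P, G) HG)).
  assert (D2 : forall P G, functional G -> injective_real (D (P, G)))
    by (intros P G HG; apply (HD (P, G) HG)).
  exists (fun Z => limit e D Z 0). split; [now apply limit_injective|].
  intros Z Phi. destruct (He Phi) as [n <-].
  pose proof (functional_condition e D D1 Z n) as HG.
  (* Stage [S n] is the first whose image lies inside the tree chosen for [e n]. *)
  pose proof (limit_condition e D D1 Z (S n)) as HL. cbn [condition] in HL.
  destruct (HD (e n, condition e D Z n) HG) as (_ & _ & [NT|(V & HV & HT)]).
  (* Totality is refuted on the whole tree, so the empty trace works; the constant 1 has no
     zeros. *)
  - destruct (computable_decides_ucemem (fun _ => 1) (computable_const 1)) as [V HV].
    exists V. split.
    + intros m. exists []. split; [simpl; lia|]. intros y Hy.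
      apply HV in Hy. discriminate.
    + intros T. exfalso. eapply NT. intros m. destruct (T m) as [y Hy].
      exists y. exact (conv_ext _ _ _ _ _ HL Hy).
  - exists V. split.
    + intros m. apply card_le_weaken with m; auto. now apply le_h_eps.
    + intros _. exists 2. intros m Hm y Hy. eapply HT; auto.
      exact (conv_ext _ _ _ _ _ HL Hy).
Qed.
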